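(* Let $\Phi$ be a real-valued continuously differentiable function with locally Lipschitz gradient on an open neighborhood of $\Delta_n$. Let $x_0\in\operatorname{ri}(\Delta_n)$, and let $(x_k)$ satisfy $$x_{k+1}\in\operatorname*{argmin}_{x\in\Delta_n}\bigl\{\mathrm{KL}(x\|x_k)+\eta_k\Phi(x)\bigr\},\qquad k\ge0,$$ where $\eta_k\ge\underline\eta>0$ for all $k$, for a fixed constant $\underline\eta$. Assume that $x_k\to x^\star\in\Delta_n$. Then $x^\star$ satisfies the KKT conditions of the problem $\min_{x\in\Delta_n}\Phi(x)$.
   Context: $\Delta_n=\{x\in\mathbb R^n: x\ge0,\ \mathbf 1^\top x=1\}$ is the probability simplex, $\mathbf 1$ is the all-ones vector, and $\operatorname{ri}(\Delta_n)=\{x\in\Delta_n: x_i>0\ \forall i\}$. $\mathrm{KL}(x\|y)=\sum_{i=1}^n x_i\log(x_i/y_i)$, with the conventions that a term with $x_i=0$ equals $0$ and a term with $x_i>0=y_i$ equals $+\infty$. The KKT conditions of $\min_{x\in\Delta_n}\Phi(x)$ at $x^\star\in\Delta_n$ are: there exist $\nu^\star\in\mathbb R$ and $\lambda^\star\in\mathbb R^n$ with $\nabla\Phi(x^\star)+\nu^\star\mathbf 1-\lambda^\star=0$, $\lambda^\star\ge0$, and $\lambda_i^\star x_i^\star=0$ for all $i$. *)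

(* Defs.v *)
From HB Require Import structures.
From mathcomp Require Import all_boot all_order all_algebra.
From mathcomp Require Import all_classical all_reals all_analysis.
Set Implicit Arguments.
Unset Strict Implicit.
Unset Printing Implicit Defensive.
Import Order.TTheory GRing.Theory Num.Theory.
Import numFieldNormedType.Exports.
Local Open Scope classical_set_scope.
Local Open Scope ring_scope.

(* Vectors of R^n are row vectors 'rV[R]_n. The norm of 'rV[R]_n is the sup
   norm, so only the topology, differentiability and (local) Lipschitz
   continuity, which do not depend on the choice of a norm, are used. *)

Definition simplex (R : realType) (n : nat) : set 'rV[R]_n :=
  [set x | (forall i, 0 <= x 0 i) /\ \sum_(i < n) x 0 i = 1].

Definition ri_simplex (R : realType) (n : nat) : set 'rV[R]_n :=
  [set x | simplex x /\ forall i, 0 < x 0 i].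

(* Only meant for nonnegative a and b; a / 0 and ln 0 are junk values of the
   library, hence the explicit case analysis. *)
Definition KL_term (R : realType) (a b : R) : \bar R :=
  if a == 0 then 0%E
  else if b == 0 then +oo%E
  else (a * ln (a / b))%:E.

Definition KL (R : realType) (n : nat) (x y : 'rV[R]_n) : \bar R :=
  (\sum_(i < n) KL_term (x 0%R i) (y 0%R i))%E.

Definition argmin (R : realType) (T : Type) (A : set T) (f : T -> \bar R) :
    set T :=
  [set x | A x /\ forall y, A y -> (f x <= f y)%E].

Definition gradient (R : realType) (n : nat) (f : 'rV[R]_n -> R)
    (x : 'rV[R]_n) : 'rV[R]_n :=
  \row_(i < n) 'D_(delta_mx 0 i) f x.

(* f is a total function, but only its values on the open set U matter. *)
Definition continuously_differentiable_on (R : realType) (n : nat)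
    (U : set 'rV[R]_n) (f : 'rV[R]_n -> R) : Prop :=
  (forall x, U x -> differentiable f x) /\
  (forall x, U x -> {for x, continuous (gradient f)}).

Definition locally_lipschitz_on (R : realType) (n m : nat)
    (U : set 'rV[R]_n) (F : 'rV[R]_n -> 'rV[R]_m) : Prop :=
  forall x, U x -> exists2 V : set 'rV[R]_n,
    nbhs x V & [lipschitz F y | y in V].

Definition KKT (R : realType) (n : nat) (Phi : 'rV[R]_n -> R)
    (x : 'rV[R]_n) : Prop :=
  exists (nu : R) (lambda : 'rV[R]_n),
    [/\ gradient Phi x + nu *: const_mx 1 - lambda = 0,
        forall i, 0 <= lambda 0 i
      & forall i, lambda 0 i * x 0 i = 0].

(* Main.v *)
Require Import Defs.
From HB Require Import structures.
From mathcomp Require Import all_boot all_order all_algebra.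
From mathcomp Require Import all_classical all_reals all_analysis.
From mathcomp Require Import ring lra.
Import Order.TTheory GRing.Theory Num.Theory.
Import numFieldNormedType.Exports.
Local Open Scope classical_set_scope.
Local Open Scope ring_scope.

(** The theorem follows from first-order optimality of each step along the
    edge directions e_i - e_j, which stay in the hyperplane of the simplex.
    Write g for the gradient of Phi.  If y minimizes KL(. || b) + eta Phi over
    the simplex and b has positive coordinates, then moving a small mass t
    from j to i cannot decrease the objective; letting t tend to 0 gives

      y_j b_i exp (eta (g_j(y) - g_i(y))) <= y_i b_j        [KL_prox_coord_le]

    for all i and j.  This is the optimality condition
    ln (y_j / b_j) + eta g_j <= ln (y_i / b_i) + eta g_i, written without
    logarithms so that it makes sense when y_i = 0.  As some y_j is positive,
    the left-hand side is then positive, so that y_i = 0 is impossible: all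
    iterates stay in the relative interior [KL_prox_gt0].

    Along the sequence, the inequality says that the ratio x_(k,i) / x_(k,j)
    is multiplied at step k by at least exp (eta_k (g_j - g_i)(x_(k+1))).
    Suppose that xstar_j > 0 and g_i(xstar) < g_j(xstar).  By continuity of g
    and since the step sizes are bounded below, these factors are eventually at
    least some q > 1, so the ratio is unbounded
    [bounded_no_geometric_growth].  But x_(k,i) <= 1 while x_(k,j) stays away
    from 0, a contradiction.  Hence g_j(xstar) <= g_i(xstar) as soon as
    xstar_j > 0, i.e. g(xstar) is minimal on the support of xstar, and the KKT
    multipliers are nu = - min g and lambda = g - min g. *)

(** Against a reference point with positive coordinates, the entropy is the
    textbook real sum: the library value 0 * ln 0 = 0 agrees with the
    convention for null coordinates. *)
Lemma KL_fin (R : realType) (n : nat) (a b : 'rV[R]_n) :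
  (forall k, 0 < b 0 k) ->
  KL a b = (\sum_(k < n) a 0 k * ln (a 0 k / b 0 k))%:E.
Proof.
move=> b0; rewrite /KL -sumEFin; apply: eq_bigr => k _; rewrite /KL_term.
by case: eqP => [->|_]; rewrite ?mul0r// gt_eqF.
Qed.

(** Convexity of u |-> u ln (u / b), through its tangent at the positive point
    c rather than at a, where the derivative may be infinite: this covers
    a = 0. *)
Lemma xlnx_tangent (R : realType) (a c b : R) : 0 <= a -> 0 < c -> 0 < b ->
  c * ln (c / b) - a * ln (a / b) <= (c - a) * (ln (c / b) + 1).
Proof.
rewrite le0r => /orP[/eqP-> c0 b0|a0 c0 b0]; first by rewrite mul0r; lra.
have ca0 : 0 < c / a by rewrite divr_gt0.
have : 1 + ln (c / a) <= c / a.
  by rewrite -[leRHS](@lnK _ (c / a)) ?posrE// expR_ge1Dx.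
rewrite !ln_div ?posrE// => /(ler_wpM2l (ltW a0)).
by rewrite (_ : a * (c / a) = c); [lra|field; rewrite gt_eqF].
Qed.

Lemma derive_coord_diff (R : realType) (n : nat) (f : 'rV[R]_n -> R)
    (y : 'rV[R]_n) (i j : 'I_n) : differentiable f y ->
  'D_(delta_mx 0 i - delta_mx 0 j) f y = gradient f y 0 i - gradient f y 0 j.
Proof. by move=> df; rewrite /gradient !mxE !deriveE// linearB. Qed.

(** Only the coordinates i and j change, and for each of them the tangent is
    taken at the new point, which is positive.  The constants 1 of the two
    tangent slopes cancel. *)
Lemma KL_transfer_le (R : realType) (n : nat) (b y : 'rV[R]_n)
    (i j : 'I_n) (t : R) :
  (forall k, 0 < b 0 k) -> (forall k, 0 <= y 0 k) -> i != j ->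
  0 < t -> t < y 0 j ->
  \sum_(k < n) ((y + t *: (delta_mx 0 i - delta_mx 0 j)) 0 k *
     ln ((y + t *: (delta_mx 0 i - delta_mx 0 j)) 0 k / b 0 k))
  - \sum_(k < n) (y 0 k * ln (y 0 k / b 0 k)) <=
  t * (ln ((y 0 i + t) / b 0 i) - ln ((y 0 j - t) / b 0 j)).
Proof.
move=> b0 y0 ij t0 tj; set z := y + _.
have zi : z 0 i = y 0 i + t by rewrite !mxE !eqxx (negPf ij)/=; ring.
have zj : z 0 j = y 0 j - t.
  by rewrite !mxE !eqxx eq_sym (negPf ij)/=; ring.
have zk k : k != i -> k != j -> z 0 k = y 0 k.
  by move=> ki kj; rewrite !mxE (negPf ki) (negPf kj)/=; ring.
rewrite -sumrB (bigD1 i)//= (bigD1 j) 1?eq_sym//= [X in _ + (_ + X)]big1.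
  have ti := @xlnx_tangent R (y 0 i) (y 0 i + t) (b 0 i) (y0 i)
    (ltr_wpDl (y0 i) t0) (b0 i).
  have tj' := @xlnx_tangent R (y 0 j) (y 0 j - t) (b 0 j) (y0 j).
  have {tj'} := tj' _ (b0 j); rewrite subr_gt0 => /(_ tj).
  by rewrite zi zj; lra.
by move=> k /andP[ki kj]; rewrite zk// subrr.
Qed.

Lemma simplex_transfer (R : realType) (n : nat) (y : 'rV[R]_n)
    (i j : 'I_n) (t : R) :
  simplex y -> 0 <= t -> t <= y 0 j ->
  simplex (y + t *: (delta_mx 0 i - delta_mx 0 j)).
Proof.
move=> [y0 y1] t0 tj; split=> [k|].
  rewrite !mxE/=; have := y0 k.
  by case: (k =P i); case: (k =P j) => [->|_] _ /=; lra.
under eq_bigr do rewrite !mxE/=.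
rewrite big_split/= y1 -mulr_sumr sumrB.
have sum_delta l : \sum_(k < n) (k == l)%:R = 1 :> R.
  by rewrite (bigD1 l)//= eqxx big1 ?addr0// => k /negPf ->.
by rewrite !sum_delta subrr mulr0 addr0.
Qed.

(** For small t > 0, comparing y with y + t (e_i - e_j), bounding the variation
    of the entropy by [KL_transfer_le] and dividing by t yields
    (y_j - t) b_i exp (- eta q(t)) <= (y_i + t) b_j, where q(t) is the
    difference quotient of Phi in that direction.  The claim is the limit as t
    tends to 0.  Exponentiating before the limit avoids ln (y_i / b_i), which
    is not yet known to be finite. *)
Lemma KL_prox_coord_le (R : realType) (n : nat) (Phi : 'rV[R]_n -> R)
    (b y : 'rV[R]_n) (eta : R) :
  (forall k, 0 < b 0 k) ->
  argmin (@simplex R n) (fun z => KL z b + (eta * Phi z)%:E)%E y ->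
  differentiable Phi y ->
  forall i j, y 0 j * b 0 i *
    expR (eta * (gradient Phi y 0 j - gradient Phi y 0 i)) <= y 0 i * b 0 j.
Proof.
move=> b0 [ys ymin] df i j; have [y0 _] := ys.
have [->|ij] := eqVneq i j; first by rewrite subrr mulr0 expR0 mulr1.
have := y0 j; rewrite le0r => /orP[/eqP->|yj].
  by rewrite !mul0r mulr_ge0// ltW.
pose d : 'rV[R]_n := delta_mx 0 i - delta_mx 0 j.
pose q (t : R) := t^-1 * (Phi (t *: d + y) - Phi y).
have qcvg : q t @[t --> 0^'+] -->
    gradient Phi y 0 i - gradient Phi y 0 j.
  rewrite -derive_coord_diff//; apply: cvg_dnbhs_at_right.
  exact: (@diff_derivable _ _ _ Phi y d df).
have tcvg : t @[t --> (0:R)^'+] --> (0 : R) by exact: cvg_at_right_filter.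
have ecvg : expR (- (eta * q t)) @[t --> 0^'+] -->
    expR (eta * (gradient Phi y 0 j - gradient Phi y 0 i)).
  rewrite (_ : eta * _ =
    - (eta * (gradient Phi y 0 i - gradient Phi y 0 j))); last by ring.
  have ncvg : - (eta * q t) @[t --> 0^'+] -->
      - (eta * (gradient Phi y 0 i - gradient Phi y 0 j)).
    by apply: cvgN; exact: cvgMr.
  exact: (cvg_comp _ _ ncvg (@continuous_expR R _)).
rewrite -[X in X * b 0 i](subr0 (y 0 j)) -[X in X * b 0 j](addr0 (y 0 i)).
apply: (@ler_cvg_to _ (0^'+) _ R
  (fun t => (y 0 j - t) * b 0 i * expR (- (eta * q t)))
  (fun t => (y 0 i + t) * b 0 j)).
- apply: cvgM => //; apply: cvgMl; apply: cvgB => //; exact: cvg_cst.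
- apply: cvgMl; apply: cvgD => //; exact: cvg_cst.
near=> t.
have t0 : 0 < t by near: t; exact: nbhs_right_gt.
have tj : t < y 0 j by near: t; exact: nbhs_right_lt.
have := ymin _ (@simplex_transfer R n y i j t ys (ltW t0) (ltW tj)).
rewrite !KL_fin// -!EFinD lee_fin => h1.
have h2 := @KL_transfer_le R n b y i j t b0 y0 ij t0 tj.
have qE : Phi (y + t *: (delta_mx 0 i - delta_mx 0 j)) = Phi y + t * q t.
  by rewrite /q mulrA divff ?gt_eqF// mul1r [RHS]addrC subrK (addrC y).
rewrite qE in h1.
have i0 : 0 < y 0 i + t by rewrite ltr_wpDl.
have j0 : 0 < y 0 j - t by rewrite subr_gt0.
have : 0 <= t * (ln ((y 0 i + t) / b 0 i) - ln ((y 0 j - t) / b 0 j)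
                 + eta * q t) by lra.
rewrite pmulr_rge0// => h3.
have : ln ((y 0 j - t) / b 0 j) - eta * q t <= ln ((y 0 i + t) / b 0 i) by lra.
rewrite -ler_expR expRD !lnK ?posrE ?divr_gt0//.
rewrite ler_pdivlMr// => /(ler_wpM2r (ltW (b0 j))).
congr (_ <= _); field; by rewrite gt_eqF.
Unshelve. all: by end_near. Qed.

Lemma simplex_pos_coord (R : realType) (n : nat) (y : 'rV[R]_n) :
  simplex y -> exists j, 0 < y 0 j.
Proof.
move=> [y0 y1]; apply: contrapT => /forallNP yN.
have : (1 : R) = 0.
  rewrite -y1 big1// => j _; apply/eqP; rewrite eq_le y0 andbT leNgt.
  exact/negP.
by move/eqP; rewrite oner_eq0.
Qed.

(** The logarithmic barrier of the entropy, obtained from [KL_prox_coord_le]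
    with j any coordinate in the support of y. *)
Lemma KL_prox_gt0 (R : realType) (n : nat) (Phi : 'rV[R]_n -> R)
    (b y : 'rV[R]_n) (eta : R) :
  (forall k, 0 < b 0 k) ->
  argmin (@simplex R n) (fun z => KL z b + (eta * Phi z)%:E)%E y ->
  differentiable Phi y -> forall i, 0 < y 0 i.
Proof.
move=> b0 ymin df i; have [j yj] := simplex_pos_coord _ _ _ ymin.1.
rewrite -(pmulr_lgt0 _ (b0 j)).
by apply: lt_le_trans (KL_prox_coord_le _ _ _ _ _ _ b0 ymin df i j);
  rewrite !mulr_gt0 ?expR_gt0.
Qed.

(** By Bernoulli's inequality r_m >= r_0 (1 + m (q - 1)), which exceeds any
    bound since R is archimedean. *)
Lemma bounded_no_geometric_growth (R : realType) (r : nat -> R) (q M : R) :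
  1 < q -> 0 < r 0%N -> (forall m, q * r m <= r m.+1) ->
  (forall m, r m <= M) -> False.
Proof.
move=> q1 r0 rS rM.
have p0 : 0 < (q - 1) * r 0%N by rewrite mulr_gt0// subr_gt0.
have lin m : r 0%N + m%:R * ((q - 1) * r 0%N) <= r m.
  elim: m => [|m IH]; first by rewrite mul0r addr0.
  apply: le_trans (rS m).
  have h : r 0%N <= r m.
    by apply: le_trans IH; rewrite lerDl mulr_ge0// ltW.
  have := @ler_wpM2l _ (q - 1) _ _ _ h; rewrite subr_ge0 => /(_ (ltW q1)).
  by rewrite -natr1; lra.
have := @archi_boundP R (`|M| / ((q - 1) * r 0%N)) _.
rewrite divr_ge0 ?(ltW p0)// => /(_ isT).
rewrite ltr_pdivrMr// => h.
have := lin (Num.bound (`|M| / ((q - 1) * r 0%N))).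
have := rM (Num.bound (`|M| / ((q - 1) * r 0%N))).
by have := ler_norm M; lra.
Qed.

Theorem proposition5p4 (R : realType) (n : nat)
    (Phi : 'rV[R]_n -> R) (U : set 'rV[R]_n)
    (hUopen : open U) (hUsimplex : @simplex R n `<=` U)
    (hPhiC1 : continuously_differentiable_on U Phi)
    (hPhiLip : locally_lipschitz_on U (gradient Phi))
    (x : nat -> 'rV[R]_n) (eta : nat -> R) (eta_low : R)
    (hx0 : ri_simplex (x 0%N))
    (heta_low : 0 < eta_low) (heta : forall k, eta_low <= eta k)
    (hstep : forall k : nat,
      argmin (@simplex R n)
        (fun y => KL y (x k) + (eta k * Phi y)%:E)%E (x k.+1))
    (xstar : 'rV[R]_n) (hxstar : simplex xstar)
    (hcvg : x k @[k --> \oo] --> xstar) :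
  KKT Phi xstar.
Proof.
have dPhi y : simplex y -> differentiable Phi y.
  by move=> /hUsimplex; exact: hPhiC1.1.
have dx k := dPhi _ (hstep k).1.
have xgt0 k i : 0 < x k 0 i.
  elim: k i => [|k IH] i; first exact: hx0.2.
  exact: (KL_prox_gt0 _ _ _ _ _ _ IH (hstep k) (dx k) i).
have xle1 k i : x k 0 i <= 1.
  have [x0 <-] : simplex (x k) by case: k => [|k]; [exact: hx0.1|exact: (hstep k).1].
  by rewrite (bigD1 i)//= lerDl sumr_ge0.
have xcvg i : x k 0 i @[k --> \oo] --> xstar 0 i.
  exact: (cvg_comp _ _ hcvg (@coord_continuous _ _ _ 0 i xstar)).
have gcvg i : gradient Phi (x k) 0 i @[k --> \oo] --> gradient Phi xstar 0 i.
  have gx := hPhiC1.2 _ (hUsimplex _ hxstar).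
  exact: (cvg_comp _ _ (cvg_comp _ _ hcvg gx) (@coord_continuous _ _ _ 0 i _)).
(* The gradient is minimal on the support of the limit. *)
have gle i j : 0 < xstar 0 j -> gradient Phi xstar 0 j <= gradient Phi xstar 0 i.
  move=> xj; rewrite leNgt; apply/negP => gij.
  (* Halving leaves room for the strict inequalities to hold eventually. *)
  pose c := xstar 0 j / 2.
  pose del := (gradient Phi xstar 0 j - gradient Phi xstar 0 i) / 2.
  have c0 : 0 < c by rewrite /c; lra.
  have d0 : 0 < del by rewrite /del; lra.
  have xc : \forall k \near \oo, c < x k 0 j.
    by apply: cvgr_gt (xcvg j) _ _; rewrite /c; lra.
  have gd : \forall k \near \oo,
      del < gradient Phi (x k) 0 j - gradient Phi (x k) 0 i.
    by apply: cvgr_gt (cvgB (gcvg j) (gcvg i)) _ _; rewrite /del; lra.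
  have [N _ hN] := filterI xc gd.
  apply: (@bounded_no_geometric_growth R
    (fun m => x (N + m)%N 0 i / x (N + m)%N 0 j)
    (expR (eta_low * del)) (1 / c)).
  - by rewrite expR_gt1 mulr_gt0.
  - by rewrite divr_gt0.
  - move=> m; rewrite addnS; set k := (N + m)%N.
    have [_ gk] := hN k.+1 (leq_trans (leq_addr m N) (leqnSn _)).
    rewrite ler_pdivlMr//.
    rewrite [leLHS](_ : _ = x k.+1 0 j * x k 0 i * expR (eta_low * del) / x k 0 j);
      last by ring.
    rewrite ler_pdivrMr//.
    apply: le_trans (KL_prox_coord_le _ _ _ _ _ _ (xgt0 k) (hstep k) (dx k) i j).
    apply: ler_wpM2l; first by rewrite mulr_ge0 ?ltW.
    by rewrite ler_expR ler_pM// ltW.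
  - move=> m; have [ck _] := hN (N + m)%N (leq_addr m N).
    apply: ler_pM; rewrite ?invr_ge0 ?(ltW (xgt0 _ _))//.
    by rewrite lef_pV2 ?posrE// ltW.
have [j xj] := simplex_pos_coord _ _ _ hxstar.
exists (- gradient Phi xstar 0 j),
  (\row_i (gradient Phi xstar 0 i - gradient Phi xstar 0 j)); split.
- by apply/rowP => i; rewrite !mxE; ring.
- by move=> i; rewrite mxE subr_ge0; exact: gle.
- move=> i; rewrite mxE.
  have := hxstar.1 i; rewrite le0r => /orP[/eqP->|xi]; first by rewrite mulr0.
  by apply/eqP; rewrite mulf_eq0 subr_eq0 eq_le !gle.
Qed.
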